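(* Let $A=\mathcal{O}_q(\mathrm{SU}(2))$ with its right coaction $\Delta_A$ of $H=\mathbb{C}[t,t^{-1}]$, with the complete differential calculus $\Omega^\bullet(A)$ described in the context, and let $B=A^{coH}$ (the Podle\'s sphere). Then the graded algebra of base space forms $\Omega^\bullet(B)=\{\omega\in\Omega^\bullet(A):\Delta_A^\wedge(\omega)=\omega\otimes 1\}$, with the restricted product and differential, is a differential calculus on $B$.
   Context: A differential calculus on an algebra $A$ is a differential $\mathbb{N}_0$-graded algebra $(\Omega^\bullet,\wedge,\mathrm{d})$ with $\Omega^0=A$ which is generated in degree zero, i.e. $\Omega^k=\mathrm{span}\{a^0\mathrm{d}a^1\wedge\cdots\wedge\mathrm{d}a^k : a^i\in A\}$. Tensor products of differential graded algebras carry the product $(\omega\otimes\eta)(\omega'\otimes\eta')=(-1)^{|\eta||\omega'|}(\omega\wedge\omega')\otimes(\eta\wedge\eta')$ and the differential $\omega\otimes\eta\mapsto \mathrm{d}\omega\otimes\eta+(-1)^{|\omega|}\omega\otimes\mathrm{d}\eta$. Let $q\in\mathbb{C}$ be a nonzero deformation parameter. The Hopf algebra $H=\mathcal{O}(\mathrm{U}(1))=\mathbb{C}[t,t^{-1}]$ has $\Delta(t)=t\otimes t$, $\epsilon(t)=1$, $S(t)=t^{-1}$; its calculus has $\Omega^1(H)=H\,\mathrm{d}t$ free of rank one with $\mathrm{d}t\,t=q^2t\,\mathrm{d}t$, and $\Omega^k(H)=0$ for $k\geq2$. $A=\mathcal{O}_q(\mathrm{SU}(2))$ is the algebra generated by $\alpha,\beta,\gamma,\delta$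 with relations $\beta\alpha=q\alpha\beta$, $\gamma\alpha=q\alpha\gamma$, $\delta\beta=q\beta\delta$, $\delta\gamma=q\gamma\delta$, $\gamma\beta=\beta\gamma$, $\delta\alpha-\alpha\delta=(q-q^{-1})\beta\gamma$, $\alpha\delta-q^{-1}\beta\gamma=1$. The coaction is the algebra map with $\Delta_A(\alpha)=\alpha\otimes t$, $\Delta_A(\beta)=\beta\otimes t^{-1}$, $\Delta_A(\gamma)=\gamma\otimes t$, $\Delta_A(\delta)=\delta\otimes t^{-1}$; $|f|$ is defined by $\Delta_A(f)=f\otimes t^{|f|}$, so $|\alpha|=|\gamma|=1$, $|\beta|=|\delta|=-1$. $B=A^{coH}=\{a\in A:\Delta_A(a)=a\otimes1\}$. $\Omega^1(A)$ is the free left $A$-module on $e^+=q^{-1}\alpha\mathrm{d}\gamma-q^{-2}\gamma\mathrm{d}\alpha$, $e^-=\delta\mathrm{d}\beta-q\beta\mathrm{d}\delta$, $e^0=\delta\mathrm{d}\alpha-q\beta\mathrm{d}\gamma$, with $e^{\pm}f=q^{|f|}fe^{\pm}$, $e^0f=q^{2|f|}fe^0$ for $f\in\{\alpha,\beta,\gamma,\delta\}$; equivalently $\mathrm{d}\alpha=\alpha e^0+q\beta e^+$, $\mathrm{d}\beta=\alpha e^--q^{-2}\beta e^0$, $\mathrm{d}\gamma=\gamma e^0+q\delta e^+$, $\mathrm{d}\delta=\gamma e^--q^{-2}\delta e^0$. $\Omega^2(A)$ is the free left $A$-module on $e^+\wedge e^-,\ e^+\wedge e^0,\ e^-\wedge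 e^0$ with $e^+\wedge e^-=-q^{-2}e^-\wedge e^+$, $e^\pm\wedge e^0=-q^{\mp4}e^0\wedge e^\pm$, $e^\pm\wedge e^\pm=e^0\wedge e^0=0$, $\mathrm{d}e^0=q^3e^+\wedge e^-$, $\mathrm{d}e^\pm=\mp q^{\pm2}[2]_{q^{-2}}e^\pm\wedge e^0$, where $[2]_{q^{-2}}=1+q^{-2}$. $\Omega^3(A)$ is the free left $A$-module on $e^+\wedge e^-\wedge e^0$, and $\Omega^k(A)=0$ for $k>3$. $\Delta_A^\wedge:\Omega^\bullet(A)\to\Omega^\bullet(A)\otimes\Omega^\bullet(H)$ is the (unique) morphism of differential graded algebras extending $\Delta_A$; it satisfies $\Delta_A^\wedge(e^\pm)=e^\pm\otimes t^{\pm2}$ and $\Delta_A^\wedge(e^0)=e^0\otimes1+1\otimes t^{-1}\mathrm{d}t$. *)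

(* Defs.v *)
From HB Require Import structures.
From mathcomp Require Import all_boot all_order all_algebra.
From mathcomp Require Import reals complex.

Set Implicit Arguments.
Unset Strict Implicit.
Unset Printing Implicit Defensive.
Import GRing.Theory.
Local Open Scope ring_scope.

(* The ground field is an arbitrary field K in the definitions; the complex
   numbers are the instance K := R[i] with R : realType. *)

Section LinearAlgebra.
Variable K : fieldType.

Definition span (V : lmodType K) (X : V -> Prop) (v : V) : Prop :=
  exists n (c : 'I_n -> K) (x : 'I_n -> V),
    (forall i, X (x i)) /\ v = \sum_i c i *: x i.

Definition is_basis (I : eqType) (V : lmodType K) (b : I -> V) : Prop :=
  (forall v, exists (s : seq I) (c : I -> K), v = \sum_(i <- s) c i *: b i)
  /\ (forall (s : seq I) (c : I -> K), uniq s ->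
        \sum_(i <- s) c i *: b i = 0 -> forall i, i \in s -> c i = 0).

Definition is_tensor (U V W : lmodType K) (tens : {bilinear U -> V -> W}) : Prop :=
  forall (X : lmodType K) (f : {bilinear U -> V -> X}),
  exists g : {linear W -> X},
    (forall u v, g (tens u v) = f u v) /\
    (forall g' : {linear W -> X}, (forall u v, g' (tens u v) = f u v) -> g' =1 g).

End LinearAlgebra.

(* The subalgebra on which two algebra morphisms agree. *)
Section Equalizer.
Variables (K : fieldType) (A T : algType K) (f g : {lrmorphism A -> T}).

Definition eqz_pred (x : A) : bool := f x == g x.

Fact eqz_pred_closed : subalg_closed eqz_pred.
Proof.
split=> [|a x y|x y]; rewrite !unfold_in /eqz_pred.
- by rewrite !rmorph1.
- move=> /eqP fx /eqP fy; apply/eqP.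
  by rewrite (linearP f) (linearP g) /= fx fy.
- by move=> /eqP fx /eqP fy; rewrite !rmorphM /= fx fy.
Qed.

HB.instance Definition _ :=
  GRing.isSubalgClosed.Build K A eqz_pred (GRing.subalg_closed_semi eqz_pred_closed).

Record equalizer := Equalizer { eqz_val : A; _ : eqz_val \in eqz_pred }.

HB.instance Definition _ := [isSub for eqz_val].
HB.instance Definition _ := [Choice of equalizer by <:].
HB.instance Definition _ := [SubChoice_isSubAlgebra of equalizer by <:].

End Equalizer.

Section Calculus.
Variable K : fieldType.

(* A graded algebra is represented by its total algebra Om together with the
   subspaces [deg k], of which Om is the direct sum. *)
Record is_dga (Om : algType K) (deg : nat -> Om -> Prop)
    (d : {linear Om -> Om}) : Prop := {
  deg_linear : forall k (a : K) x y, deg k x -> deg k y -> deg k (a *: x + y);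
  deg_zero : forall k, deg k 0;
  deg_decomp : forall w, exists n (x : nat -> Om),
    (forall k, deg k (x k)) /\ w = \sum_(k < n) x k;
  deg_indep : forall n (x : nat -> Om), (forall k, deg k (x k)) ->
    \sum_(k < n) x k = 0 -> forall k, (k < n)%N -> x k = 0;
  deg_one : deg 0%N 1;
  deg_mul : forall j k x y, deg j x -> deg k y -> deg (j + k)%N (x * y);
  deg_d : forall k x, deg k x -> deg k.+1 (d x);
  d_d : forall x, d (d x) = 0;
  d_leibniz : forall k x y, deg k x ->
    d (x * y) = d x * y + (-1) ^+ k * (x * d y) }.

Record dga := Dga {
  dga_alg :> algType K;
  dga_deg : nat -> dga_alg -> Prop;
  dga_d : {linear dga_alg -> dga_alg};
  dgaP : is_dga dga_deg dga_d }.

(* [iota] identifies A with the degree zero part. *)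
Record generated_over (A Om : algType K) (iota : {lrmorphism A -> Om})
    (deg : nat -> Om -> Prop) (d : Om -> Om) : Prop := {
  iota_inj : injective iota;
  deg0E : forall w, deg 0%N w <-> exists a, w = iota a;
  deg_span : forall k w, deg k w <->
    span (fun v => exists (a0 : A) (a : 'I_k -> A),
            v = iota a0 * \prod_(i < k) d (iota (a i))) w }.

Definition is_calculus (A Om : algType K) (iota : {lrmorphism A -> Om})
    (deg : nat -> Om -> Prop) (d : {linear Om -> Om}) : Prop :=
  is_dga deg d /\ generated_over iota deg d.

Record calculus (A : algType K) := Calculus {
  cal_dga :> dga;
  cal_inj : {lrmorphism A -> cal_dga};
  calP : generated_over cal_inj (@dga_deg cal_dga) (@dga_d cal_dga) }.

Definition free_left_basis (A : algType K) (Om : calculus A) (k n : nat)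
    (e : n.-tuple Om) : Prop :=
  (forall w : Om, dga_deg k w <->
     exists a : 'I_n -> A, w = \sum_i cal_inj Om (a i) * tnth e i)
  /\ (forall a : 'I_n -> A,
        \sum_i cal_inj Om (a i) * tnth e i = 0 -> forall i, a i = 0).

End Calculus.

Section TensorProducts.
Variable K : fieldType.

Record alg_tensor (A H : algType K) := AlgTensor {
  at_alg :> algType K;
  at_tens : {bilinear A -> H -> at_alg};
  at_univ : is_tensor at_tens;
  at_one : at_tens 1 1 = 1;
  at_mul : forall a h a' h',
    at_tens a h * at_tens a' h' = at_tens (a * a') (h * h') }.

Record dga_tensor (X Y : dga K) := DgaTensor {
  dt_dga :> dga K;
  dt_tens : {bilinear X -> Y -> dt_dga};
  dt_univ : is_tensor dt_tens;
  dt_deg : forall n w, dga_deg n w <->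
    span (fun v => exists i j x y,
            [/\ (i + j = n)%N, dga_deg i x, dga_deg j y & v = dt_tens x y]) w;
  dt_one : dt_tens 1 1 = 1;
  dt_mul : forall j k (x : X) (y : Y) (x' : X) (y' : Y),
    dga_deg j y -> dga_deg k x' ->
    dt_tens x y * dt_tens x' y' = (-1) ^+ (j * k) * dt_tens (x * x') (y * y');
  dt_d : forall i (x : X) (y : Y), dga_deg i x ->
    dga_d _ (dt_tens x y) =
      dt_tens (dga_d _ x) y + (-1) ^+ i * dt_tens x (dga_d _ y) }.

Record dga_morphism (X Y : dga K) := DgaMorphism {
  dm_fun :> {lrmorphism X -> Y};
  dm_deg : forall k x, dga_deg k x -> dga_deg k (dm_fun x);
  dm_d : forall x, dm_fun (dga_d _ x) = dga_d _ (dm_fun x) }.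

Section AlgTensorOne.
Variables (A H : algType K) (T : alg_tensor A H).
Definition at_tens1 (a : A) : T := at_tens T a 1.

Fact at_tens1_linear : linear at_tens1.
Proof. by move=> c x y; rewrite /at_tens1 linearPl. Qed.
HB.instance Definition _ := GRing.isLinear.Build K A T _ at_tens1 at_tens1_linear.

Fact at_tens1_monoid : monoid_morphism at_tens1.
Proof. by split=> [|x y]; rewrite /at_tens1 ?at_one // at_mul mulr1. Qed.
HB.instance Definition _ := GRing.isMonoidMorphism.Build A T at_tens1 at_tens1_monoid.
End AlgTensorOne.

Section DgaTensorOne.
Variables (X Y : dga K) (T : dga_tensor X Y).
Definition dt_tens1 (x : X) : T := dt_tens T x 1.

Fact dt_tens1_linear : linear dt_tens1.
Proof. by move=> c x y; rewrite /dt_tens1 linearPl. Qed.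
HB.instance Definition _ := GRing.isLinear.Build K X T _ dt_tens1 dt_tens1_linear.

Fact dt_tens1_monoid : monoid_morphism dt_tens1.
Proof.
split=> [|x y]; first exact: dt_one.
have [n [z [degz ->]]] := deg_decomp (dgaP X) y.
rewrite mulr_sumr !linear_sum mulr_sumr; apply: eq_bigr => k _ /=.
rewrite /dt_tens1 (dt_mul T x 1 (deg_one (dgaP Y)) (degz k)).
by rewrite mul0n expr0 mul1r mulr1.
Qed.
HB.instance Definition _ := GRing.isMonoidMorphism.Build X T dt_tens1 dt_tens1_monoid.
End DgaTensorOne.

(* {a | Delta a = a (x) 1} *)
Definition coinvariants (A H : algType K) (AH : alg_tensor A H)
    (Delta : {lrmorphism A -> AH}) : Type :=
  equalizer Delta (@at_tens1 A H AH).

(* {w | Delta^ w = w (x) 1} *)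
Definition base_forms (X Y : dga K) (T : dga_tensor X Y)
    (DeltaW : dga_morphism X T) : Type :=
  equalizer DeltaW (@dt_tens1 X Y T).

(* [DeltaW] restricts to (iota_A (x) iota_H) o Delta in degree zero. *)
Definition extends_coaction (A H : algType K) (AH : alg_tensor A H)
    (Delta : {lrmorphism A -> AH}) (OmA : calculus A) (OmH : calculus H)
    (T : dga_tensor OmA OmH) (DeltaW : dga_morphism OmA T) : Prop :=
  exists J : {linear AH -> T},
    (forall a h, J (at_tens AH a h) = dt_tens T (cal_inj OmA a) (cal_inj OmH h))
    /\ (forall a, DeltaW (cal_inj OmA a) = J (Delta a)).

End TensorProducts.

HB.instance Definition _ (K : fieldType) (A H : algType K) (AH : alg_tensor A H)
    (Delta : {lrmorphism A -> AH}) :=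
  GRing.SubAlgebra.on (coinvariants Delta).
HB.instance Definition _ (K : fieldType) (X Y : dga K) (T : dga_tensor X Y)
    (DeltaW : dga_morphism X T) :=
  GRing.SubAlgebra.on (base_forms DeltaW).

Section QuantumSU2.
Variables (K : fieldType) (q : K).

Record OqSU2_relations (A : algType K) (al be ga de : A) : Prop := {
  rel_beal : be * al = q *: (al * be);
  rel_gaal : ga * al = q *: (al * ga);
  rel_debe : de * be = q *: (be * de);
  rel_dega : de * ga = q *: (ga * de);
  rel_gabe : ga * be = be * ga;
  rel_deal : de * al - al * de = (q - q^-1) *: (be * ga);
  rel_qdet : al * de - q^-1 *: (be * ga) = 1 }.

(* A is presented by the generators al, be, ga, de and the relations above. *)
Definition is_OqSU2 (A : algType K) (al be ga de : A) : Prop :=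
  OqSU2_relations al be ga de /\
  forall (A' : algType K) (al' be' ga' de' : A'),
    OqSU2_relations al' be' ga' de' ->
    exists f : {lrmorphism A -> A'},
      [/\ f al = al', f be = be', f ga = ga' & f de = de'] /\
      (forall g : {lrmorphism A -> A'},
         [/\ g al = al', g be = be', g ga = ga' & g de = de'] -> g =1 f).

Section Forms.
Variables (A : algType K) (al be ga de : A) (Om : calculus A).
Local Notation i := (cal_inj Om).
Local Notation d := (@dga_d _ Om).

Definition e_plus : Om := q^-1 *: (i al * d (i ga)) - q ^- 2 *: (i ga * d (i al)).
Definition e_minus : Om := i de * d (i be) - q *: (i be * d (i de)).
Definition e_zero : Om := i de * d (i al) - q *: (i be * d (i ga)).

Local Notation ep := e_plus.
Local Notation em := e_minus.
Local Notation e0 := e_zero.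

(* [f] paired with |f| *)
Definition weighted_generators : seq (A * int) :=
  [:: (al, 1); (be, -1); (ga, 1); (de, -1)].

Record is_SU2_calculus : Prop := {
  su2_free1 : free_left_basis 1 [tuple ep; em; e0];
  su2_comm : forall f n, (f, n) \in weighted_generators ->
    [/\ ep * i f = q ^ n *: (i f * ep),
        em * i f = q ^ n *: (i f * em) &
        e0 * i f = q ^ (2 * n) *: (i f * e0)];
  su2_free2 : free_left_basis 2 [tuple ep * em; ep * e0; em * e0];
  su2_epem : ep * em = - q ^- 2 *: (em * ep);
  su2_epe0 : ep * e0 = - q ^- 4 *: (e0 * ep);
  su2_eme0 : em * e0 = - q ^+ 4 *: (e0 * em);
  su2_sqr : [/\ ep * ep = 0, em * em = 0 & e0 * e0 = 0];
  su2_de0 : d e0 = q ^+ 3 *: (ep * em);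
  su2_dep : d ep = - (q ^+ 2 * (1 + q ^- 2)) *: (ep * e0);
  su2_dem : d em = (q ^- 2 * (1 + q ^- 2)) *: (em * e0);
  su2_free3 : free_left_basis 3 [tuple ep * em * e0];
  su2_top : forall k w, (3 < k)%N -> @dga_deg _ Om k w -> w = 0 }.

End Forms.

(* H = K[t, t^-1]; [t ^ k] is the integer power. *)
Definition is_OU1 (H : unitAlgType K) (t : H) : Prop :=
  t \is a GRing.unit /\ is_basis (fun k : int => t ^ k).

Record is_U1_calculus (H : unitAlgType K) (t : H) (Om : calculus H) : Prop := {
  u1_free1 : free_left_basis 1 [tuple dga_d Om (cal_inj Om t)];
  u1_comm : dga_d Om (cal_inj Om t) * cal_inj Om t =
    q ^+ 2 *: (cal_inj Om t * dga_d Om (cal_inj Om t));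
  u1_top : forall k w, (2 <= k)%N -> @dga_deg _ Om k w -> w = 0 }.

End QuantumSU2.

(* Main.v *)
Require Import Defs.
From HB Require Import structures.
From mathcomp Require Import all_boot all_order all_algebra.
From mathcomp Require Import reals complex boolp.
From mathcomp Require Import ring.
Set Implicit Arguments.
Unset Strict Implicit.
Unset Printing Implicit Defensive.
Import GRing.Theory.
Local Open Scope ring_scope.

(** Write [t] for the generator of [H], [theta = t^-1 dt] for its invariant
form, and say that [f] in [A] has weight [n] when [Delta f = f (x) t^n].

The generators of [A] have weights [1] and [-1], so [A] is spanned by elements
that have a weight ([weight_decomposition]).  A computation on generators gives
[Delta^ e+ = e+ (x) t^2], [Delta^ e- = e- (x) t^-2] and
[Delta^ e0 = e0 (x) 1 + 1 (x) theta].  Thus [e+] and [e-] behave like functions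
of weight [2] and [-2], and only [e0] produces a term in [theta].  Forms on [H]
have coordinates along the [t^n] and the [t^n theta], so contracting the right
tensor factor with the coordinate of [1], resp. of [theta], gives linear maps
[P] and [Q] out of the tensor product ([invariant_projections]).  If [w] is a
base form then [P (Delta^ w) = w] and [Q (Delta^ w) = 0].  Expand
[w = u + v e0] with [u], [v] in the left [A]-span of products of [e+] and [e-].
The map [P] keeps of each coefficient the component whose weight makes the
term invariant, and [Q] extracts the invariant part of [v]; therefore this part
vanishes and [w] is the invariant part of [u].  Consequently the base forms are
- in degree 0, the [f] of weight 0, that is, the algebra [B];
- in degree 1, the [f e+ + g e-] with [f] of weight [-2] and [g] of weight [2];
- in degree 2, the [f e+ e-] with [f] of weight 0;
- zero in degrees at least 3.

It remains to generate them.  The elements [al be], [be ga], [ga de] have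
weight 0, and [coframe_exact] writes [e+] and [e-] as combinations of their
differentials with coefficients quadratic in [al, ga], resp. [be, de]:
<<
  e+ = al^2 d(ga de) - (1 + q^-2) al ga d(be ga) + q^-2 ga^2 d(al be)
  e- = de^2 d(al be) - (q^2 + 1) be de d(be ga) + q^2 be^2 d(ga de)
>>
Multiplying by [f] of weight [-2], resp. [2], makes the coefficients weight 0,
hence elements of [B].  For [f e+ e-], expand [e-] and move its coefficients,
of weight [-2], to the left of [e+], up to a power of [q]; then expand [e+].

The closure of base forms under the differential and under taking homogeneous
components ([base_forms_dga]) holds for any morphism of differential graded
algebras [X -> X (x) Y]. *)

Local Notation span := Defs.span.

(** * Spans and coordinate functionals *)

Section Span.
Variables (K : fieldType) (V : lmodType K) (X : V -> Prop).

Lemma mem_span v : X v -> span X v.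
Proof.
move=> Xv; exists 1%N, (fun=> 1), (fun=> v); split=> //.
by rewrite big_ord1 scale1r.
Qed.

Lemma span0 : span X 0.
Proof. by exists 0%N, (fun=> 0), (fun=> 0); split=> [[]|]; rewrite ?big_ord0. Qed.

Lemma spanZ a v : span X v -> span X (a *: v).
Proof.
move=> [n [c [x [Xx ->]]]]; exists n, (fun i => a * c i), x; split=> //.
by rewrite scaler_sumr; apply: eq_bigr => i _; rewrite scalerA.
Qed.

Lemma spanD u v : span X u -> span X v -> span X (u + v).
Proof.
move=> [n [c [x [Xx ->]]]] [m [c' [y [Xy ->]]]].
exists (n + m)%N, (fun i => match split i with inl j => c j | inr j => c' j end),
  (fun i => match split i with inl j => x j | inr j => y j end); split.
  by move=> i; case: (split i).
rewrite big_split_ord /=; congr (_ + _); apply: eq_bigr => i _.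
  by have := unsplitK (inl i : 'I_n + 'I_m)%type; rewrite /= => ->.
by have := unsplitK (inr i : 'I_n + 'I_m)%type; rewrite /= => ->.
Qed.

Lemma span_ind (P : V -> Prop) :
  (forall a u v, P u -> P v -> P (a *: u + v)) -> P 0 ->
  (forall v, X v -> P v) -> forall v, span X v -> P v.
Proof.
move=> PD P0 PX v [n [c [x [Xx ->]]]].
elim/big_ind: _ => // [u w Pu Pw|i _].
  by rewrite -[u]scale1r; apply: PD.
by rewrite -[_ *: _]addr0; apply: PD => //; apply: PX.
Qed.

End Span.

Section Functionals.
Variable K : fieldType.

(** Linear maps are constructed below from total linear relations; such a
relation is single-valued as soon as its fibre over 0 is. *)
Lemma linear_of_graph (U V : lmodType K) (G : U -> V -> Prop) :
  (forall u, exists v, G u v) ->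
  (forall a u v u' v', G u v -> G u' v' -> G (a *: u + u') (a *: v + v')) ->
  (forall v, G 0 v -> v = 0) ->
  exists f : {linear U -> V}, forall u v, G u v -> f u = v.
Proof.
move=> Gex Glin G0; have [f Gf] := choice Gex.
have Guniq u v v' : G u v -> G u v' -> v = v'.
  move=> Guv Guv'; apply/eqP; rewrite -subr_eq0; apply/eqP/G0.
  by have := Glin (-1) _ _ _ _ Guv' Guv; rewrite !scaleN1r addNr addrC.
have f_lin : linear f by move=> a x y; apply: (Guniq (a *: x + y)); auto.
pose fM := GRing.isLinear.Build K U V _ f f_lin.
pose fL : {linear U -> V} := HB.pack f fM.
by exists fL => u v; apply: Guniq (Gf u).
Qed.

(** Independence of a basis extends to families of indices with repetitions,
which is the form in which elements of a span come. *)
Lemma basis_regroup (I : eqType) (V : lmodType K) (b : I -> V) :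
  is_basis b -> forall n (c : 'I_n -> K) (j : 'I_n -> I),
  \sum_k c k *: b (j k) = 0 -> forall i, \sum_(k | j k == i) c k = 0.
Proof.
move=> [_ b_free] n c j sum0 i; set s := undup (codom j).
have js k : j k \in s by rewrite mem_undup codom_f.
have [si|/negP si] := boolP (i \in s); last first.
  by apply: big1 => k /eqP jk; case: si; rewrite -jk.
apply: (b_free s (fun i => \sum_(k | j k == i) c k) (undup_uniq _)) => //.
(* Group the terms of the sum by the value of the index. *)
rewrite -[RHS]sum0.
under eq_bigr => l _ do rewrite scaler_suml.
rewrite (exchange_big_dep predT) //=; apply: eq_bigr => k _.
under eq_bigl => l do rewrite eq_sym.
by rewrite -big_filter filter_pred1_uniq ?undup_uniq ?js // big_seq1.
Qed.

(** The coordinate of [v] along [b i] is the scalar [a] such that [v - a b_i]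
lies in the span of the other basis vectors. *)
Lemma basis_coordinate (I : eqType) (V : lmodType K) (b : I -> V) (i : I) :
  is_basis b ->
  exists x : {linear V -> K^o}, forall j, x (b j) = (j == i)%:R.
Proof.
move=> b_basis; have [b_span _] := b_basis.
pose G (v : V) (a : K^o) :=
  span (fun w => exists j, j != i /\ w = b j) (v - a *: b i).
have Gb j : G (b j) (j == i)%:R.
  rewrite /G; have [->|ji] := eqVneq; first by rewrite scale1r subrr; apply: span0.
  by rewrite scale0r subr0; apply: mem_span; exists j.
have Glin a u v u' v' : G u v -> G u' v' -> G (a *: u + u') (a *: v + v').
  rewrite /G => Gu Gu'.
  have -> : a *: u + u' - (a *: v + v') *: b i
    = a *: (u - v *: b i) + (u' - v' *: b i).
    by rewrite scalerBr scalerDl scalerA addrACA opprD.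
  by apply: spanD Gu'; apply: spanZ.
have [v|a|x xP] := @linear_of_graph V K^o G _ Glin; last by exists x => j; apply: xP.
- have [s [c ->]] := b_span v.
  elim/big_rec: _ => [|j w _ [a Ga]]; first by
    exists 0; rewrite /G scale0r subr0; apply: span0.
  by exists (c j *: ((j == i)%:R : K^o) + a); apply: Glin.
- rewrite /G sub0r => -[n [c [x [/choice[j jP] xE]]]].
  have {}xE : - (a *: b i) = \sum_k c k *: b (j k).
    by rewrite xE; apply: eq_bigr => k _; have [_ ->] := jP k.
  pose c' k := oapp c a (unlift ord0 k); pose j' k := oapp j i (unlift ord0 k).
  have := @basis_regroup _ _ _ b_basis _ c' j'.
  rewrite big_ord_recl /c' /j' unlift_none /=.
  under eq_bigr => k _ do rewrite liftK.
  rewrite -xE subrr => /(_ erefl i); rewrite big_mkcond big_ord_recl unlift_none eqxx.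
  rewrite big1 => [|k _]; first by move=> /(etrans (esym (addr0 _))).
  by rewrite liftK /=; have [/negPf-> _] := jP k.
Qed.

End Functionals.

(** * Differential graded algebras and their tensor products *)

Section Dga.
Variable K : fieldType.

Lemma d_one (X : dga K) : dga_d X 1 = 0.
Proof.
have := d_leibniz (dgaP X) 1 (deg_one (dgaP X)).
rewrite expr0 !mul1r !mulr1 => /eqP.
by rewrite -subr_eq0 opprD addNKr oppr_eq0 => /eqP.
Qed.

Lemma d_leibniz0 (X : dga K) (x y : X) :
  dga_deg 0 x -> dga_d X (x * y) = dga_d X x * y + x * dga_d X y.
Proof. by move=> x0; rewrite (d_leibniz (dgaP X) y x0) expr0 mul1r. Qed.

Lemma deg_inj0 (A : algType K) (Om : calculus A) (a : A) : dga_deg 0 (cal_inj Om a).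
Proof. by apply/(deg0E (calP Om)); exists a. Qed.

Lemma dga_ind (X : dga K) (P : X -> Prop) :
  P 0 -> (forall x y, P x -> P y -> P (x + y)) ->
  (forall k x, dga_deg k x -> P x) -> forall x, P x.
Proof.
move=> P0 PD Phom x; have [n [z [degz ->]]] := deg_decomp (dgaP X) x.
by elim/big_ind: _ => // k _; apply: Phom (degz k).
Qed.

Section Tensor.
Variables (X Y : dga K) (T : dga_tensor X Y).
Local Notation "x '(x)' y" := (dt_tens T x y) (at level 40).

(** A right factor of degree 0 makes the Koszul sign trivial, so homogeneity of
[x'] can be dropped. *)
Lemma tens_mul0 (x x' : X) (y y' : Y) :
  dga_deg 0 y -> (x (x) y) * (x' (x) y') = (x * x') (x) (y * y').
Proof.
move=> y0; elim/dga_ind: x' => [|u v IHu IHv|k x' x'k].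
- by rewrite mulr0 !linear0l mulr0.
- by rewrite mulrDr !linearDl mulrDr IHu IHv.
- by rewrite (dt_mul T x y' y0 x'k) mul0n expr0 mul1r.
Qed.

Lemma d_tens0 (x : X) (y : Y) : dga_deg 0 x ->
  dga_d T (x (x) y) = dga_d X x (x) y + x (x) dga_d Y y.
Proof. by move=> x0; rewrite (dt_d T y x0) expr0 mul1r. Qed.

Lemma d_tens1 (x : X) : dga_d T (x (x) 1) = dga_d X x (x) 1.
Proof.
elim/dga_ind: x => [|x y IHx IHy|k x xk].
- by rewrite !(linear0, linear0l).
- by rewrite linearD linearDl !linearD /= IHx IHy linearDl.
- by rewrite (dt_d T 1 xk) d_one linear0r mulr0 addr0.
Qed.

Lemma deg_tens1 k (x : X) : dga_deg k x -> dga_deg k (x (x) 1).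
Proof.
move=> xk; apply/dt_deg/mem_span; exists k, 0%N, x, 1; split=> //.
  exact: addn0.
exact: deg_one (dgaP Y).
Qed.

(** A functional on the right factor induces a map out of the tensor product.
This is the only use of its universal property, and replaces any choice of
bases in the tensor product. *)
Lemma tensor_contraction (chi : {linear Y -> K^o}) :
  exists P : {linear T -> X}, forall x y, P (x (x) y) = chi y *: x.
Proof.
pose f (x : X) (y : Y) : X := chi y *: x.
have f_bilin : bilinear_for *:%R *:%R f.
  split=> [y|x] a u v; rewrite /f.
    by rewrite /= scalerDr !scalerA [_ * a]mulrC.
  by rewrite /= linearP scalerDl scalerA.
pose fM := bilinear_isBilinear.Build K X Y X *:%R *:%R f f_bilin.
pose fB : {bilinear X -> Y -> X} := HB.pack f fM.
by have [P [PE _]] := dt_univ T fB; exists P => x y; rewrite PE.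
Qed.
End Tensor.

End Dga.

(** * The differential graded algebra of base forms *)

Section BaseForms.
Variables (K : fieldType) (X Y : dga K) (T : dga_tensor X Y).
Variable DeltaW : dga_morphism X T.
Local Notation base := (base_forms DeltaW).

Lemma base_formP (w : X) : reflect (DeltaW w = dt_tens T w 1) (w \in eqz_pred DeltaW (dt_tens1 T)).
Proof. exact: eqP. Qed.

Lemma base_form_val (w : base) : DeltaW (val w) = dt_tens T (val w) 1.
Proof. exact/base_formP/(valP w). Qed.

Fact base_d_subproof (w : base) : dga_d X (val w) \in eqz_pred DeltaW (dt_tens1 T).
Proof. by apply/base_formP; rewrite dm_d base_form_val d_tens1. Qed.

Definition base_d (w : base) : base := Equalizer (base_d_subproof w).

Fact base_d_linear : linear base_d.
Proof.
move=> a x y; apply: val_inj.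
rewrite -[LHS]/(dga_d X (val (a *: x + y))).
by rewrite !linearP.
Qed.
HB.instance Definition _ := GRing.isLinear.Build K base base _ base_d base_d_linear.

Lemma val_base_sum (I : Type) (s : seq I) (F : I -> base) :
  val (\sum_(i <- s) F i) = \sum_(i <- s) val (F i).
Proof. exact: (raddf_sum (val : base -> X)). Qed.

(** The difference [Delta^ x - x (x) 1] preserves degrees, so it vanishes on a sum
of homogeneous elements only if it vanishes on each of them. *)
Lemma base_form_component n (x : nat -> X) : (forall k, dga_deg k (x k)) ->
  \sum_(k < n) x k \in eqz_pred DeltaW (dt_tens1 T) ->
  forall k, (k < n)%N -> x k \in eqz_pred DeltaW (dt_tens1 T).
Proof.
move=> xk /base_formP xb k kn; apply/base_formP/eqP; rewrite -subr_eq0; apply/eqP.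
apply: (deg_indep (dgaP T) (n := n) (x := fun k => DeltaW (x k) - dt_tens T (x k) 1)) => //.
- move=> j; rewrite -scaleN1r addrC; apply: deg_linear (dgaP T) _ _ _ _ _ _.
    exact: deg_tens1.
  exact: dm_deg.
- by rewrite sumrB -linear_sum /= xb linear_sumlz subrr.
Qed.

(** All axioms are inherited from [X] through the injection [val]; only the
existence of homogeneous components requires an argument. *)
Lemma base_forms_dga : is_dga (fun k (w : base) => dga_deg k (val w)) base_d.
Proof.
split.
- move=> k a x y xk yk; rewrite linearD linearZ /=.
  exact: deg_linear (dgaP X) _ _ _ _ xk yk.
- by move=> k; rewrite linear0; apply: deg_zero (dgaP X) k.
- move=> w; have [n [x [xk wE]]] := deg_decomp (dgaP X) (val w).
  have xb k : (k < n)%N -> x k \in eqz_pred DeltaW (dt_tens1 T).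
    by apply: base_form_component => //; rewrite -wE; apply: valP.
  (* Beyond the bound n nothing is known of x k, whence the default 0. *)
  exists n, (fun k => insubd (0 : base) (x k)); split=> [k|].
    rewrite val_insubd; case: ifP => // _; rewrite linear0.
    exact: deg_zero (dgaP X) k.
  apply: val_inj; rewrite val_base_sum wE; apply: eq_bigr => k _.
  by rewrite insubdK ?xb.
- move=> n x xk sum0 k kn; apply: val_inj; rewrite linear0.
  apply: (deg_indep (dgaP X) (n := n) (x := fun k => val (x k))) => //.
  by rewrite -val_base_sum sum0 linear0.
- by rewrite rmorph1; apply: deg_one (dgaP X).
- by move=> j k x y xj yk; rewrite rmorphM; apply: (deg_mul (dgaP X) xj yk).
- by move=> k x xk; apply: (deg_d (dgaP X) xk).
- by move=> x; apply: val_inj; rewrite linear0; apply: (d_d (dgaP X)).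
- move=> k x y xk; apply: val_inj.
  rewrite -[LHS]/(dga_d X (val (x * y))) linearD !rmorphM rmorphXn rmorphN1.
  exact: (d_leibniz (dgaP X) _ xk).
Qed.

End BaseForms.

(** * Induction over a presented algebra *)

Section Subalgebra.
Variables (K : fieldType) (A : algType K) (P : A -> Prop).
Hypotheses (P1 : P 1) (PD : forall a x y, P x -> P y -> P (a *: x + y)).
Hypothesis PM : forall x y, P x -> P y -> P (x * y).

(** The closure hypotheses occur in the body so that the subalgebra structure of
[subalg] can be found from the predicate alone. *)
Definition subalg_pred (x : A) : bool :=
  let _ := (P1, PD, PM) in `[< P x >].

Fact subalg_pred_closed : GRing.subalg_closed subalg_pred.
Proof.
split=> [|a x y|x y]; rewrite !unfold_in /subalg_pred.
- exact/asboolP.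
- by move=> /asboolP Px /asboolP Py; apply/asboolP/PD.
- by move=> /asboolP Px /asboolP Py; apply/asboolP/PM.
Qed.

HB.instance Definition _ := GRing.isSubalgClosed.Build K A subalg_pred
  (GRing.subalg_closed_semi subalg_pred_closed).

Record subalg := Subalg { subalg_val : A; _ : subalg_val \in subalg_pred }.

HB.instance Definition _ := [isSub for subalg_val].
HB.instance Definition _ := [Choice of subalg by <:].
HB.instance Definition _ := [SubChoice_isSubAlgebra of subalg by <:].

Definition subalg_incl : subalg -> A := val.
HB.instance Definition _ := GRing.RMorphism.copy subalg_incl val.
HB.instance Definition _ := GRing.Linear.copy subalg_incl val.

Lemma subalgP (x : A) : P x -> x \in subalg_pred.
Proof. by move=> Px; apply/asboolP. Qed.

Lemma subalg_valP (x : subalg) : P (val x).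
Proof. by have /asboolP := valP x. Qed.

(** By the universal property there is a morphism from [A] to the subalgebra cut
out by [P] that fixes the generators; by uniqueness its composite with the
inclusion is the identity. *)
Lemma OqSU2_ind_subproof (q : K) (al be ga de : A) :
  is_OqSU2 q al be ga de -> P al -> P be -> P ga -> P de -> forall a, P a.
Proof.
move=> [rel univ] Pal Pbe Pga Pde a.
have rel' : OqSU2_relations q (Subalg (subalgP Pal)) (Subalg (subalgP Pbe))
    (Subalg (subalgP Pga)) (Subalg (subalgP Pde)).
  case: rel => *; split; apply: val_inj;
  by rewrite ?linearB ?linearZ ?rmorphM ?rmorph1 //= ?scalerN.
have [f [[fal fbe fga fde] _]] := univ _ _ _ _ _ rel'.
have [g [_ g_uniq]] := univ _ _ _ _ _ rel.
have valf := g_uniq (subalg_incl \o f : {lrmorphism A -> A}).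
have idg := g_uniq (idfun : {lrmorphism A -> A}).
rewrite -[a]/(idfun a) idg // -valf; first exact: subalg_valP.
by rewrite /= fal fbe fga fde.
Qed.
End Subalgebra.

Lemma OqSU2_ind (K : fieldType) (q : K) (A : algType K) (al be ga de : A)
    (P : A -> Prop) :
  is_OqSU2 q al be ga de ->
  P 1 -> (forall a x y, P x -> P y -> P (a *: x + y)) ->
  (forall x y, P x -> P y -> P (x * y)) ->
  P al -> P be -> P ga -> P de -> forall a, P a.
Proof. by move=> hA P1 PD PM; apply: OqSU2_ind_subproof hA. Qed.

(** * Forms on the circle *)

Section CircleForms.
Variables (K : fieldType) (q : K) (H : unitAlgType K) (t : H) (OmH : calculus H).
Hypotheses (hH : is_OU1 t) (hOmH : is_U1_calculus q t OmH).
Local Notation i := (cal_inj OmH).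
Local Notation dt := (dga_d OmH (i t)).

Lemma U1_form_decomp (w : OmH) : exists h0 h1, w = i h0 + i h1 * dt.
Proof.
elim/dga_ind: w => [|x y [x0 [x1 ->]] [y0 [y1 ->]]|[|[|k]] w wk].
- by exists 0, 0; rewrite linear0 mul0r addr0.
- by exists (x0 + y0), (x1 + y1); rewrite !linearD mulrDl addrACA.
- have [h ->] := (deg0E (calP OmH) w).1 wk.
  by exists h, 0; rewrite linear0 mul0r addr0.
- have [h ->] := ((u1_free1 hOmH).1 w).1 wk.
  by exists 0, (h ord0); rewrite big_ord1 linear0 add0r.
- by exists 0, 0; rewrite (u1_top hOmH _ wk) // linear0 mul0r addr0.
Qed.

Lemma deg_dt h : dga_deg 1 (i h * dt).
Proof. by apply/(u1_free1 hOmH).1; exists (fun=> h); rewrite big_ord1. Qed.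

(** The two terms have different degrees, and [H -> H dt] is injective. *)
Lemma U1_form_uniq h0 h1 : i h0 + i h1 * dt = 0 -> h0 = 0 /\ h1 = 0.
Proof.
move=> sum0; pose x k : OmH := if k is k'.+1 then
  if k' is 0%N then i h1 * dt else 0 else i h0.
have xk k : dga_deg k (x k).
  case: k => [|[|k]]; [exact: deg_inj0 | exact: deg_dt | exact: deg_zero (dgaP _) _].
have x0 := @deg_indep _ _ _ _ (dgaP OmH) 2 x xk.
rewrite big_ord_recl big_ord1 in x0.
split; first by apply: (iota_inj (calP OmH)); rewrite linear0; apply: (x0 _ 0%N).
apply: ((u1_free1 hOmH).2 (fun=> h1) _ ord0).
by rewrite big_ord1; apply: (x0 _ 1%N).
Qed.

Lemma U1_functional (k0 k1 : {linear H -> K^o}) :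
  exists x : {linear OmH -> K^o}, forall h0 h1, x (i h0 + i h1 * dt) = k0 h0 + k1 h1.
Proof.
pose G (w : OmH) (a : K^o) :=
  exists h0 h1, w = i h0 + i h1 * dt /\ a = k0 h0 + k1 h1.
have [w|a u v u' v'|v|x xG] := @linear_of_graph _ OmH K^o G.
- by have [h0 [h1 wE]] := U1_form_decomp w; exists (k0 h0 + k1 h1), h0, h1.
- move=> [h0 [h1 [-> ->]]] [h0' [h1' [-> ->]]].
  exists (a *: h0 + h0'), (a *: h1 + h1'); rewrite !linearP mulrDl -scalerAl scalerDr.
  by rewrite addrACA; split=> //; rewrite scalerDr addrACA.
- by move=> [h0 [h1 [/esym/U1_form_uniq[-> ->] ->]]]; rewrite !linear0 addr0.
- by exists x => h0 h1; apply: xG; exists h0, h1.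
Qed.

(** The form [t^-1 dt], invariant under the group. *)
Definition maurer_cartan : OmH := i t^-1 * dt.

(** [P] reads the coefficient of [1] in the right factor and [Q] that of
[t^-1 dt]. *)
Lemma invariant_projections (X : dga K) (T : dga_tensor X OmH) :
  exists P Q : {linear T -> X},
    [/\ forall n w, P (dt_tens T w (i (t ^ n))) = (n == 0)%:R *: w,
        forall n w, P (dt_tens T w (i (t ^ n) * maurer_cartan)) = 0,
        forall n w, Q (dt_tens T w (i (t ^ n))) = 0 &
        forall n w, Q (dt_tens T w (i (t ^ n) * maurer_cartan)) = (n == 0)%:R *: w].
Proof.
have [t_unit t_basis] := hH.
have [k kE] := basis_coordinate 0 t_basis.
(* As t^n theta = t^(n-1) dt, the index 0 for theta is the index -1 for dt. *)
have [l lE] := basis_coordinate (-1) t_basis.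
have [x xE] := U1_functional k \0; have [y yE] := U1_functional \0 l.
have [P PE] := tensor_contraction T x; have [Q QE] := tensor_contraction T y.
have ithE n : i (t ^ n) * maurer_cartan = i (t ^ (n - 1)) * dt.
  by rewrite /maurer_cartan mulrA -rmorphM exprzDr.
have xi h : x (i h) = k h by have := xE h 0; rewrite !linear0 mul0r !addr0.
have yi h : y (i h) = 0 by have := yE h 0; rewrite !linear0 mul0r !addr0.
have xd h : x (i h * dt) = 0 by have := xE 0 h; rewrite !linear0 !add0r.
have yd h : y (i h * dt) = l h by have := yE 0 h; rewrite !linear0 !add0r.
exists P, Q; split=> n w; rewrite ?PE ?QE ?ithE.
- by rewrite xi kE.
- by rewrite xd scale0r.
- by rewrite yi scale0r.
- by rewrite yd lE -subr_eq0 opprK subrK.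
Qed.
End CircleForms.

(** * Equality of linear combinations *)

Section LinComb.
Variables (K : pzRingType) (V : lmodType K).
Lemma lincomb_merge (k l : K) (m r : V) : k *: m + (l *: m + r) = (k + l) *: m + r.
Proof. by rewrite addrA scalerDl. Qed.
Lemma lincomb_swap (k l : K) (n m r : V) :
  k *: n + (l *: m + r) = l *: m + (k *: n + r).
Proof. exact: addrCA. Qed.
Lemma lincomb_drop (k : K) (m r : V) : k = 0 -> r = 0 -> k *: m + r = 0.
Proof. by move=> -> ->; rewrite scale0r add0r. Qed.
Lemma lincomb_intro (x y : V) : x - y + 0 = 0 -> x = y.
Proof. by move/eqP; rewrite addr0 subr_eq0 => /eqP. Qed.
Lemma lincomb_scale (x r : V) : x + r = 1 *: x + r.
Proof. by rewrite scale1r. Qed.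
Lemma lincomb_scaleN (x r : V) : - x + r = (-1) *: x + r.
Proof. by rewrite scaleN1r. Qed.
End LinComb.

(** Puts every summand of a right-nested sum into the form [k *: m], as the
merging lemmas require. *)
Ltac lincomb_scale_from r :=
  match r with
  | _ *: _ + ?r' => lincomb_scale_from r'
  | - ?x + ?r' => rewrite (@lincomb_scaleN _ _ x r'); lincomb_scale_from r'
  | ?x + ?r' => rewrite (@lincomb_scale _ _ x r'); lincomb_scale_from r'
  | _ => idtac
  end.

(** Brings the summands in [m] to the head of the sum, adding up their
coefficients. *)
Ltac lincomb_gather m :=
  repeat first [rewrite (lincomb_merge _ _ m) | rewrite (lincomb_swap _ _ _ m)].

(** Proves an equality of linear combinations of monomials by comparing the
coefficients of equal monomials; [side] proves the resulting equalities of
scalars. *)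
Ltac lincomb side :=
  apply: lincomb_intro; rewrite ?(opprD, opprK, =^~ scaleNr, =^~ addrA);
  match goal with |- ?r = 0 => lincomb_scale_from r end;
  repeat match goal with
  | |- _ *: ?m + _ = 0 =>
      lincomb_gather m; apply: lincomb_drop; first by side
  end; try reflexivity.

(** * Quadratic identities in the quantum group *)

Section Frame.
Variables (K : fieldType) (q : K) (O : algType K) (a b c d : O).
Hypotheses (q0 : q != 0) (rel : OqSU2_relations q a b c d).

Lemma quantum_det_flip : d * a = 1 + q *: (b * c).
Proof.
rewrite -[d * a](subrK (a * d)) (rel_deal rel).
rewrite -(rel_qdet rel).
lincomb ltac:(ring).
Qed.

(** Oriented from left to right, these rules move [b] and [c] to the left and
eliminate products of [a] and [d]; they terminate in a linear combination of
monomials [b^i c^j a^k] and [b^i c^j d^k], so they bring the two sides of an identity to a common form. *)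
Lemma straighten2 :
  (a * b = q^-1 *: (b * a)) * (a * c = q^-1 *: (c * a)) *
  (d * b = q *: (b * d)) * (d * c = q *: (c * d)) * (c * b = b * c) *
  (a * d = 1 + q^-1 *: (b * c)) * (d * a = 1 + q *: (b * c)).
Proof.
rewrite (rel_beal rel) (rel_gaal rel) !scalerA mulVf // !scale1r.
do !split; rewrite ?quantum_det_flip //; try by case: rel.
by rewrite -(rel_qdet rel) subrK.
Qed.

(** The same rules under a left factor [x], for products associated to the
left. *)
Lemma straighten3 (x : O) :
  (x * a * b = q^-1 *: (x * b * a)) * (x * a * c = q^-1 *: (x * c * a)) *
  (x * d * b = q *: (x * b * d)) * (x * d * c = q *: (x * c * d)) *
  (x * c * b = x * b * c) *
  (x * a * d = x + q^-1 *: (x * b * c)) * (x * d * a = x + q *: (x * b * c)).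
Proof. by rewrite -!mulrA !straighten2 !mulrDr mulr1 -!scalerAr. Qed.

End Frame.

Ltac straighten q0 rel :=
  rewrite ?(mulrDl, mulrDr, mulNr, mulrN, scalerDr, scalerN, scalerA,
    =^~ scalerAl, =^~ scalerAr, mulrA, mul1r, mulr1, straighten2 q0 rel,
    straighten3 q0 rel).


(** Here [a, b, c, d] are the generators and [da, db, dc, dd] their differentials.
The ambient algebra is arbitrary, since only the bimodule relations and the
Leibniz rule on two of the defining relations enter. *)
Section Coframe.
Variables (K : fieldType) (q : K) (O : algType K) (a b c d : O).
Hypotheses (q0 : q != 0) (rel : OqSU2_relations q a b c d).
Variables (ep em e0 da db dc dd : O).
Hypotheses (epE : ep = q^-1 *: (a * dc) - q ^- 2 *: (c * da))
  (emE : em = d * db - q *: (b * dd)) (e0E : e0 = d * da - q *: (b * dc)).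
Hypotheses
  (epC : (ep * a = q *: (a * ep)) * (ep * b = q^-1 *: (b * ep)) *
         (ep * c = q *: (c * ep)) * (ep * d = q^-1 *: (d * ep)))
  (emC : (em * a = q *: (a * em)) * (em * b = q^-1 *: (b * em)) *
         (em * c = q *: (c * em)) * (em * d = q^-1 *: (d * em)))
  (e0C : (e0 * a = q ^+ 2 *: (a * e0)) * (e0 * b = q ^- 2 *: (b * e0)) *
         (e0 * c = q ^+ 2 *: (c * e0)) * (e0 * d = q ^- 2 *: (d * e0))).
Hypotheses (leib_bc : dc * b + c * db = db * c + b * dc)
  (leib_det : da * d + a * dd - q^-1 *: (db * c + b * dc) = 0).

Let ep3 x : (x * ep * a = q *: (x * a * ep)) * (x * ep * b = q^-1 *: (x * b * ep)) *
         (x * ep * c = q *: (x * c * ep)) * (x * ep * d = q^-1 *: (x * d * ep)).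
Proof. by rewrite -!mulrA !epC -!scalerAr. Qed.
Let em3 x : (x * em * a = q *: (x * a * em)) * (x * em * b = q^-1 *: (x * b * em)) *
         (x * em * c = q *: (x * c * em)) * (x * em * d = q^-1 *: (x * d * em)).
Proof. by rewrite -!mulrA !emC -!scalerAr. Qed.
Let e03 x : (x * e0 * a = q ^+ 2 *: (x * a * e0)) * (x * e0 * b = q ^- 2 *: (x * b * e0)) *
         (x * e0 * c = q ^+ 2 *: (x * c * e0)) * (x * e0 * d = q ^- 2 *: (x * d * e0)).
Proof. by rewrite -!mulrA !e0C -!scalerAr. Qed.

Ltac straighten_forms :=
  straighten q0 rel; rewrite ?(epC, emC, e0C, ep3, em3, e03); straighten q0 rel.
Ltac form_identity := straighten_forms; lincomb ltac:(field).

(** The definitions of [e0] and [e+] are a linear system in [da] and [dc] whose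
matrix is invertible by the quantum determinant. *)
Lemma daE : da = a * e0 + q *: (b * ep).
Proof. by rewrite e0E epE; form_identity. Qed.
Lemma dcE : dc = c * e0 + q *: (d * ep).
Proof. by rewrite e0E epE; form_identity. Qed.

(** Differentiating [a d - q^-1 b c = 1] yields a second equation between [db]
and [dd], independent of the definition of [e-]. *)
Lemma antidiagonal_e0 : a * dd - q^-1 *: (c * db) = - q ^- 2 *: e0.
Proof.
move: leib_det; rewrite -leib_bc => det0.
rewrite -[LHS]subr0 -det0 daE dcE; form_identity.
Qed.

(** Solve the system formed by [emE] and [antidiagonal_e0]. *)
Lemma dbE : db = a * em - q ^- 2 *: (b * e0).
Proof. by rewrite -scaleNr scalerAr -antidiagonal_e0 emE; form_identity. Qed.
Lemma ddE : dd = c * em - q ^- 2 *: (d * e0).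
Proof. by rewrite -scaleNr scalerAr -antidiagonal_e0 emE; form_identity. Qed.

(** The terms in [e0] cancel in the differentials of the weight 0 products. *)
Lemma d_ab : da * b + a * db = b * b * ep + a * a * em.
Proof. by rewrite daE dbE; form_identity. Qed.
Lemma d_bc : db * c + b * dc = q *: (b * d * ep + a * c * em).
Proof. by rewrite dbE dcE; form_identity. Qed.
Lemma d_cd : dc * d + c * dd = d * d * ep + c * c * em.
Proof. by rewrite dcE ddE; form_identity. Qed.

(** The coefficients come from inserting the determinant relation into itself:
[a (a d - q^-1 c b) d - q^-1 c (a d - q^-1 c b) b = 1].  The same coefficients
applied to the [e-] parts [c c], [a c], [a a] give 0, because
[a c - q^-1 c a = 0]. *)
Lemma ep_exact : ep = a * a * (dc * d + c * dd)
  - (1 + q ^- 2) *: (a * c * (db * c + b * dc)) + q ^- 2 *: (c * c * (da * b + a * db)).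
Proof. by rewrite d_ab d_bc d_cd; form_identity. Qed.
(** As for [ep_exact], starting from [d a - q b c = 1] and [d b - q b d = 0]. *)
Lemma em_exact : em = d * d * (da * b + a * db)
  - (q ^+ 2 + 1) *: (b * d * (db * c + b * dc)) + q ^+ 2 *: (b * b * (dc * d + c * dd)).
Proof. by rewrite d_ab d_bc d_cd; form_identity. Qed.
End Coframe.

Lemma OqSU2_relations_rmorph (K : fieldType) (q : K) (A O : algType K)
    (f : {lrmorphism A -> O}) (al be ga de : A) :
  OqSU2_relations q al be ga de ->
  OqSU2_relations q (f al) (f be) (f ga) (f de).
Proof.
case=> r1 r2 r3 r4 r5 r6 r7.
by split; rewrite -?(rmorphM f) -?(linearZ_LR f) -?(linearB f) /=
  ?(r1, r2, r3, r4, r5, r6, r7) ?rmorph1.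
Qed.

(** * Degree zero and generation, for a general coaction *)

Section BaseInclusion.
Variables (K : fieldType) (A H : algType K) (AH : alg_tensor A H).
Variables (Delta : {lrmorphism A -> AH}) (OmA : calculus A) (OmH : calculus H).
Variables (T : dga_tensor OmA OmH) (DeltaW : dga_morphism OmA T).
Hypothesis ext : extends_coaction Delta DeltaW.
Local Notation B := (coinvariants Delta).
Local Notation base := (base_forms DeltaW).
Local Notation i := (cal_inj OmA).
Local Notation D := (dga_d OmA).

Lemma coinvariant_val (b : B) : Delta (val b) = at_tens AH (val b) 1.
Proof. exact/eqP/(valP b). Qed.

Lemma DeltaW_inj a h : Delta a = at_tens AH a h ->
  DeltaW (i a) = dt_tens T (i a) (cal_inj OmH h).
Proof. by case: ext => J [Jtens JDelta] ah; rewrite JDelta ah Jtens. Qed.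

Fact base_inj_subproof (b : B) : i (val b) \in eqz_pred DeltaW (dt_tens1 T).
Proof.
by apply/base_formP; rewrite (DeltaW_inj (coinvariant_val b)) rmorph1.
Qed.

Definition base_inj (b : B) : base := Equalizer (base_inj_subproof b).

Fact base_inj_linear : linear base_inj.
Proof.
move=> a x y; apply: val_inj.
by rewrite -[LHS]/(i (val (a *: x + y))) !linearP.
Qed.
HB.instance Definition _ := GRing.isLinear.Build K B base _ base_inj base_inj_linear.

Fact base_inj_monoid : monoid_morphism base_inj.
Proof.
split=> [|x y]; apply: val_inj; first by rewrite -[LHS]/(i (val 1)) !rmorph1.
by rewrite -[LHS]/(i (val (x * y))) !rmorphM.
Qed.
HB.instance Definition _ := GRing.isMonoidMorphism.Build B base base_inj base_inj_monoid.

(** Spanning is checked for forms on [A], where one can compute; [base_span_val]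
transports it to base forms. *)
Definition base_monomial k (v : OmA) : Prop :=
  exists (a0 : B) (a : 'I_k -> B), v = i (val a0) * \prod_(j < k) D (i (val (a j))).

Lemma val_base_monomial k (a0 : B) (a : 'I_k -> B) :
  val (base_inj a0 * \prod_(j < k) base_d (base_inj (a j))) =
  i (val a0) * \prod_(j < k) D (i (val (a j))).
Proof. by rewrite rmorphM rmorph_prod. Qed.

Lemma base_span_val k (w : base) :
  span (fun v => exists (a0 : B) (a : 'I_k -> B),
    v = base_inj a0 * \prod_(j < k) base_d (base_inj (a j))) w
  <-> span (base_monomial k) (val w).
Proof.
split=> [[n [c [x [xP ->]]]]|[n [c [x [/choice[a0 /choice[a xE]] wE]]]]].
  rewrite val_base_sum; exists n, c, (fun j => val (x j)); split=> [j|].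
    by have [a0 [a ->]] := xP j; exists a0, a; rewrite val_base_monomial.
  by apply: eq_bigr => j _; rewrite linearZ.
exists n, c, (fun l => base_inj (a0 l) * \prod_(j < k) base_d (base_inj (a l j))).
split=> [l|]; first by exists (a0 l), (a l).
apply: val_inj; rewrite wE val_base_sum; apply: eq_bigr => l _.
by rewrite linearZ xE; congr (_ *: _); rewrite -val_base_monomial.
Qed.

Lemma base_span_deg k (v : OmA) : span (base_monomial k) v -> dga_deg k v.
Proof.
move=> v_span; apply/(deg_span (calP OmA)).
have [n [c [x [xP ->]]]] := v_span; exists n, c, x; split=> // j.
by have [a0 [a ->]] := xP j; exists (val a0), (fun l => val (a l)).
Qed.

(** What has to be known about base forms beyond the general theory: their
degree 0 part is [B], and in positive degrees they are sums of monomials. *)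
Lemma base_calculus :
  (forall w : base, dga_deg 0 (val w) -> exists b, w = base_inj b) ->
  (forall k (w : base), (0 < k)%N -> dga_deg k (val w) -> span (base_monomial k) (val w)) ->
  is_calculus base_inj (fun k (w : base) => dga_deg k (val w)) (@base_d _ _ _ T DeltaW).
Proof.
move=> deg0 degS; split; first exact: base_forms_dga.
split.
- move=> x y /(congr1 val)/(iota_inj (calP OmA)); exact: val_inj.
- by move=> w; split=> [/deg0//|[b ->]]; apply: deg_inj0.
- move=> k w; split=> [wk|/base_span_val]; last exact: base_span_deg.
  apply/base_span_val; case: k wk => [/deg0[b ->]|k wk]; last exact: degS.
  by apply: mem_span; exists b, (fun=> b); rewrite big_ord0 mulr1.
Qed.

End BaseInclusion.

(** * Base forms of the quantum Hopf fibration *)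

Section Podles.
Variables (K : fieldType) (q : K) (q0 : q != 0).
Variables (A : algType K) (al be ga de : A) (hA : is_OqSU2 q al be ga de).
Variables (H : unitAlgType K) (t : H) (hH : is_OU1 t).
Variables (AH : alg_tensor A H) (Delta : {lrmorphism A -> AH}).
Hypothesis hDelta : [/\ Delta al = at_tens AH al t, Delta be = at_tens AH be t^-1,
                  Delta ga = at_tens AH ga t & Delta de = at_tens AH de t^-1].
Variables (OmA : calculus A) (hOmA : is_SU2_calculus q al be ga de OmA).
Variables (OmH : calculus H) (hOmH : is_U1_calculus q t OmH).
Variables (T : dga_tensor OmA OmH) (DeltaW : dga_morphism OmA T).
Hypothesis ext : extends_coaction Delta DeltaW.
Local Notation B := (coinvariants Delta).
Local Notation base := (base_forms DeltaW).
Local Notation i := (cal_inj OmA).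
Local Notation D := (dga_d OmA).
Local Notation iH := (cal_inj OmH).
Local Notation "x '(x)' y" := (dt_tens T x y) (at level 40).
Local Notation ep := (e_plus q al ga OmA).
Local Notation em := (e_minus q be de OmA).
Local Notation e0 := (e_zero q al be ga de OmA).
Local Notation theta := (maurer_cartan t OmH).

Let t_unit : t \is a GRing.unit := hH.1.
Let rel : OqSU2_relations q al be ga de := hA.1.
Let relF : OqSU2_relations q (i al) (i be) (i ga) (i de) :=
  OqSU2_relations_rmorph i rel.

Definition weight (n : int) (a : A) : Prop := Delta a = at_tens AH a (t ^ n).

Lemma weight1 : weight 0 1.
Proof. by rewrite /weight rmorph1 expr0z at_one. Qed.

Lemma weightP n k x y : weight n x -> weight n y -> weight n (k *: x + y).
Proof. by move=> xn yn; rewrite /weight linearP /= xn yn linearPl. Qed.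

Lemma weight0 n : weight n 0.
Proof. by rewrite /weight linear0 linear0l. Qed.

Lemma weightM m n x y : weight m x -> weight n y -> weight (m + n) (x * y).
Proof. by move=> xm yn; rewrite /weight rmorphM /= xm yn at_mul -exprzDr. Qed.

Lemma weight_al : weight 1 al. Proof. by case: hDelta. Qed.
Lemma weight_ga : weight 1 ga. Proof. by case: hDelta. Qed.
Lemma weight_be : weight (-1) be.
Proof. by rewrite /weight exprN1; case: hDelta. Qed.
Lemma weight_de : weight (-1) de.
Proof. by rewrite /weight exprN1; case: hDelta. Qed.

Lemma weight_decomposition a : span (fun x => exists n, weight n x) a.
Proof.
apply: (OqSU2_ind hA).
- by apply: mem_span; exists 0; apply: weight1.
- by move=> k x y Sx Sy; apply: spanD Sy; apply: spanZ.
- move=> x y Sx Sy; elim/span_ind: Sx => [k u v Su Sv||u [m um]].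
  + by rewrite mulrDl -scalerAl; apply: spanD Sv; apply: spanZ.
  + by rewrite mul0r; apply: span0.
  elim/span_ind: Sy => [k v w Sv Sw||v [n vn]].
  + by rewrite mulrDr -scalerAr; apply: spanD Sw; apply: spanZ.
  + by rewrite mulr0; apply: span0.
  by apply: mem_span; exists (m + n); apply: weightM.
- by apply: mem_span; exists 1; apply: weight_al.
- by apply: mem_span; exists (-1); apply: weight_be.
- by apply: mem_span; exists 1; apply: weight_ga.
- by apply: mem_span; exists (-1); apply: weight_de.
Qed.

(** The analogue of [weight] for forms, satisfied only by forms without a [theta]
term. *)
Definition horizontal_weight (n : int) (w : OmA) : Prop := DeltaW w = w (x) iH (t ^ n).

Lemma horizontal_weightM m n u v :
  horizontal_weight m u -> horizontal_weight n v -> horizontal_weight (m + n) (u * v).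
Proof.
move=> um vn; rewrite /horizontal_weight rmorphM /= um vn.
by rewrite tens_mul0 ?exprzDr // ?rmorphM //; apply: deg_inj0.
Qed.

Lemma weight_inj n a : weight n a -> horizontal_weight n (i a).
Proof. exact: DeltaW_inj. Qed.

Lemma horizontal_weight1 : horizontal_weight 0 1.
Proof. by rewrite -(rmorph1 i); apply/weight_inj/weight1. Qed.

(** The last term cancels in [e+] and [e-] by commutation of the generators, and
adds up to [1 (x) theta] in [e0] by the quantum determinant. *)
Lemma DeltaW_mul_d m n f g : weight m f -> weight n g ->
  DeltaW (i f * D (i g)) = (i f * D (i g)) (x) iH (t ^ (m + n))
    + (i f * i g) (x) (iH (t ^ m) * dga_d OmH (iH (t ^ n))).
Proof.
move=> /weight_inj fm /weight_inj gn.
rewrite rmorphM /= dm_d fm gn d_tens0; last exact: deg_inj0.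
rewrite mulrDr !tens_mul0; try exact: deg_inj0.
by rewrite exprzDr // rmorphM.
Qed.

Lemma horizontal_ep : horizontal_weight 2 ep.
Proof.
rewrite /horizontal_weight /e_plus linearB !(linearZ_LR DeltaW) /=.
rewrite (DeltaW_mul_d weight_al weight_ga) (DeltaW_mul_d weight_ga weight_al).
rewrite (rel_gaal relF) linearBl !linearZl_LR /= ?scalerDr ?scalerA.
by lincomb ltac:(field).
Qed.

Lemma horizontal_em : horizontal_weight (-2) em.
Proof.
rewrite /horizontal_weight /e_minus linearB !(linearZ_LR DeltaW) /=.
rewrite (DeltaW_mul_d weight_de weight_be) (DeltaW_mul_d weight_be weight_de).
rewrite (rel_debe relF) linearBl !linearZl_LR /= ?scalerDr ?scalerA.
by lincomb ltac:(field).
Qed.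

Lemma DeltaW_e0 : DeltaW e0 = e0 (x) 1 + 1 (x) theta.
Proof.
rewrite /e_zero linearB !(linearZ_LR DeltaW) /=.
rewrite (DeltaW_mul_d weight_de weight_al) (DeltaW_mul_d weight_be weight_ga).
rewrite (quantum_det_flip relF) exprN1 expr1z addNr expr0z rmorph1 -/theta.
rewrite linearBl linearDl !linearZl_LR /= ?scalerDr ?scalerA.
by lincomb ltac:(field).
Qed.

Lemma DeltaW_mul_e0 n u : horizontal_weight n u ->
  DeltaW (u * e0) = (u * e0) (x) iH (t ^ n) + u (x) (iH (t ^ n) * theta).
Proof.
move=> un; rewrite rmorphM /= un DeltaW_e0 mulrDr !tens_mul0; try exact: deg_inj0.
by rewrite !mulr1.
Qed.

(** Here [P] and [Q] are the maps of [invariant_projections]. *)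
Section Projections.
Variables P Q : {linear T -> OmA}.
Hypotheses
  (P0 : forall n w, P (w (x) iH (t ^ n)) = (n == 0)%:R *: w)
  (P1 : forall n w, P (w (x) (iH (t ^ n) * theta)) = 0)
  (Q0 : forall n w, Q (w (x) iH (t ^ n)) = 0)
  (Q1 : forall n w, Q (w (x) (iH (t ^ n) * theta)) = (n == 0)%:R *: w).

(** The element [f'] is the component of weight [n] of [f].  The decomposition of
[f] into weights need not be known to be unique: linearity of the four
equations suffices. *)
Lemma weight_component n v f : horizontal_weight (- n) v ->
  exists2 f', weight n f' &
    [/\ P (DeltaW (i f * v)) = i f' * v, Q (DeltaW (i f * v)) = 0,
        P (DeltaW (i f * v * e0)) = i f' * v * e0 &
        Q (DeltaW (i f * v * e0)) = i f' * v].
Proof.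
move=> vn; elim/span_ind: (weight_decomposition f) => [k x y||x [m xm]].
- move=> [x' x'n [Px Qx Px0 Qx0]] [y' y'n [Py Qy Py0 Qy0]].
  exists (k *: x' + y'); first exact: weightP.
  rewrite !(linearP i) !mulrDl -!scalerAl !(linearP DeltaW) !(linearP P) !(linearP Q) /=.
  by rewrite Px Qx Px0 Qx0 Py Qy Py0 Qy0 scaler0 addr0.
- by exists 0; [exact: weight0 | rewrite !linear0 !mul0r !linear0].
have xv := horizontal_weightM (weight_inj xm) vn.
exists ((m - n == 0)%:R *: x).
  have [/eqP|_] := eqVneq (m - n) 0; last by rewrite scale0r; apply: weight0.
  by rewrite subr_eq0 => /eqP<-; rewrite scale1r.
rewrite (DeltaW_mul_e0 xv) xv !linearD /= !P0 !P1 !Q0 !Q1.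
by rewrite (linearZ_LR i) /= -!scalerAl addr0 add0r.
Qed.

Lemma projection_base_form w : DeltaW w = w (x) 1 -> P (DeltaW w) = w.
Proof.
by move=> ->; have := P0 0 w; rewrite expr0z rmorph1 eqxx scale1r.
Qed.

Lemma residue_base_form w : DeltaW w = w (x) 1 -> Q (DeltaW w) = 0.
Proof. by move=> ->; have := Q0 0 w; rewrite expr0z rmorph1. Qed.

Lemma base_form0_weight a : DeltaW (i a) = i a (x) 1 -> weight 0 a.
Proof.
have [a' a'0 [Pa _ _ _]] := weight_component a (n := 0) horizontal_weight1.
move=> /projection_base_form; rewrite mulr1 in Pa; rewrite Pa mulr1.
by move=> /(iota_inj (calP OmA))<-.
Qed.

(** [Q] isolates the component of weight 0 of the coefficient of [e0]. *)
Lemma base_form1_horizontal w : dga_deg 1 w -> DeltaW w = w (x) 1 ->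
  exists f g, [/\ weight (-2) f, weight 2 g & w = i f * ep + i g * em].
Proof.
move=> /(su2_free1 hOmA).1[x]; rewrite !big_ord_recl big_ord0 addr0 /=.
set f := x _; set g := x _; set h := x _ => wE wb.
have [f' f'n [Pf Qf _ _]] := weight_component f (n := -2) horizontal_ep.
have [g' g'n [Pg Qg _ _]] := weight_component g (n := 2) horizontal_em.
have [h' h'n [_ _ Ph Qh]] := weight_component h (n := 0) horizontal_weight1.
rewrite -[i h]mulr1 in wE; rewrite !mulr1 in Ph Qh wE.
have h'0 : i h' = 0 by rewrite -(residue_base_form wb) wE !linearD /= Qf Qg Qh !add0r.
exists f', g'; split=> //.
by rewrite -[LHS](projection_base_form wb) wE !linearD /= Pf Pg Ph h'0 mul0r addr0.
Qed.

(** [Q] gives [g' e+ + h' e- = 0] for the relevant components of the coefficients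
of [e+ e0] and [e- e0]; multiply by [e0]. *)
Lemma base_form2_top w : dga_deg 2 w -> DeltaW w = w (x) 1 ->
  exists2 f, weight 0 f & w = i f * (ep * em).
Proof.
move=> /(su2_free2 hOmA).1[x]; rewrite !big_ord_recl big_ord0 addr0 /=.
set f := x _; set g := x _; set h := x _ => wE wb; rewrite !mulrA in wE.
have := weight_component f (n := 0) (horizontal_weightM horizontal_ep horizontal_em).
move=> [f' f'n [Pf Qf _ _]]; rewrite !mulrA in Pf Qf.
have [g' g'n [_ _ Pg Qg]] := weight_component g (n := -2) horizontal_ep.
have [h' h'n [_ _ Ph Qh]] := weight_component h (n := 2) horizontal_em.
have gh0 : i g' * ep + i h' * em = 0.
  by rewrite -(residue_base_form wb) wE !linearD /= Qf Qg Qh add0r.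
exists f' => //; rewrite -[LHS](projection_base_form wb) wE !linearD /= Pf Pg Ph.
by rewrite -mulrDl gh0 mul0r addr0 mulrA.
Qed.

(** [Q] gives [f' e+ e- = 0]; multiply by [e0]. *)
Lemma base_form3_zero w : dga_deg 3 w -> DeltaW w = w (x) 1 -> w = 0.
Proof.
move=> /(su2_free3 hOmA).1[x]; rewrite big_ord1 /= => wE wb; rewrite mulrA in wE.
have := weight_component (x ord0) (n := 0)
  (horizontal_weightM horizontal_ep horizontal_em).
move=> [f' f'n [_ _ Pf Qf]].
have f'0 : i f' * (ep * em) = 0 by rewrite -(residue_base_form wb) wE Qf.
by rewrite -[LHS](projection_base_form wb) wE Pf f'0 mul0r.
Qed.

End Projections.

Lemma base_monomial1 x y : weight 0 x -> weight 0 y ->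
  base_monomial Delta (OmA := OmA) 1 (i x * D (i y)).
Proof.
move=> x0 y0.
have inB z : weight 0 z -> z \in eqz_pred Delta (at_tens1 AH).
  by move=> z0; apply/eqP; rewrite z0 expr0z.
exists (Equalizer (inB x x0)), (fun=> Equalizer (inB y y0)).
by rewrite big_ord1.
Qed.

Lemma base_span_mul_d k w y : weight 0 y -> span (base_monomial Delta (OmA := OmA) k) w ->
  span (base_monomial Delta (OmA := OmA) k.+1) (w * D (i y)).
Proof.
move=> y0; elim/span_ind=> [c u v Su Sv||v [a0 [a ->]]].
- by rewrite mulrDl -scalerAl; apply: spanD Sv; apply: spanZ.
- by rewrite mul0r; apply: span0.
have yB : y \in eqz_pred Delta (at_tens1 AH) by apply/eqP; rewrite y0 expr0z.
apply: mem_span; exists a0, (fun j => oapp a (Equalizer yB) (unlift ord_max j)).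
(* The differential of y is the last factor of the new monomial. *)
rewrite big_ord_recr /= unlift_none mulrA; congr (_ * _ * _).
apply: eq_bigr => j _; congr (D (i (val _))).
by rewrite (_ : widen_ord _ _ = lift ord_max j) ?liftK //; apply/val_inj/esym/lift_max.
Qed.

Lemma d_inj_mul x y : D (i x) * i y + i x * D (i y) = D (i (x * y)).
Proof. by rewrite rmorphM /= d_leibniz0 //; apply: deg_inj0. Qed.

Let gen_comm f n : (f, n) \in weighted_generators al be ga de ->
  [/\ ep * i f = q ^ n *: (i f * ep), em * i f = q ^ n *: (i f * em) &
      e0 * i f = q ^ (2 * n) *: (i f * e0)] := su2_comm hOmA (f := f) (n := n).
Let gen_al : (al, 1 : int) \in weighted_generators al be ga de.
Proof. by rewrite !inE eqxx. Qed.
Let gen_be : (be, -1 : int) \in weighted_generators al be ga de.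
Proof. by rewrite !inE eqxx !orbT. Qed.
Let gen_ga : (ga, 1 : int) \in weighted_generators al be ga de.
Proof. by rewrite !inE eqxx !orbT. Qed.
Let gen_de : (de, -1 : int) \in weighted_generators al be ga de.
Proof. by rewrite !inE eqxx !orbT. Qed.

Lemma comm_ep :
  (ep * i al = q *: (i al * ep)) * (ep * i be = q^-1 *: (i be * ep)) *
  (ep * i ga = q *: (i ga * ep)) * (ep * i de = q^-1 *: (i de * ep)).
Proof.
by have [? _ _] := gen_comm gen_al; have [? _ _] := gen_comm gen_be;
   have [? _ _] := gen_comm gen_ga; have [? _ _] := gen_comm gen_de.
Qed.

Lemma coframe_exact :
  ep = i (al * al) * D (i (ga * de))
       - (1 + q ^- 2) *: (i (al * ga) * D (i (be * ga)))
       + q ^- 2 *: (i (ga * ga) * D (i (al * be))) /\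
  em = i (de * de) * D (i (al * be))
       - (q ^+ 2 + 1) *: (i (be * de) * D (i (be * ga)))
       + q ^+ 2 *: (i (be * be) * D (i (ga * de))).
Proof.
have [_ ma za] := gen_comm gen_al; have [_ mb zb] := gen_comm gen_be.
have [_ mc zc] := gen_comm gen_ga; have [_ md zd] := gen_comm gen_de.
have leib_bc : D (i ga) * i be + i ga * D (i be) = D (i be) * i ga + i be * D (i ga).
  by rewrite !d_inj_mul (rel_gabe rel).
have leib_det : D (i al) * i de + i al * D (i de)
    - q^-1 *: (D (i be) * i ga + i be * D (i ga)) = 0.
  by rewrite !d_inj_mul -!linearZ -!linearB (rel_qdet rel) rmorph1 d_one.
have emC := (ma, mb, mc, md); have e0C := (za, zb, zc, zd).
have epx := @ep_exact _ _ _ _ _ _ _ q0 relF _ _ _ _ _ _ _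
  (erefl ep) (erefl em) (erefl e0) comm_ep emC e0C leib_bc leib_det.
have emx := @em_exact _ _ _ _ _ _ _ q0 relF _ _ _ _ _ _ _
  (erefl ep) (erefl em) (erefl e0) comm_ep emC e0C leib_bc leib_det.
by split; [rewrite {1}epx | rewrite {1}emx]; rewrite !d_inj_mul !rmorphM.
Qed.

Let weight0_prod m n k x y z : weight m x -> weight n y -> weight k z ->
  m + (n + k) = 0 -> weight 0 (x * (y * z)).
Proof. by move=> xm yn zk <-; apply: weightM xm _; apply: weightM. Qed.

Let weight_ab : weight 0 (al * be). Proof. exact: weightM weight_al weight_be. Qed.
Let weight_bc : weight 0 (be * ga). Proof. exact: weightM weight_be weight_ga. Qed.
Let weight_cd : weight 0 (ga * de). Proof. exact: weightM weight_ga weight_de. Qed.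

(** The coefficients in [coframe_exact] have weight 2, so their products with [f]
lie in [B]. *)
Lemma span_ep f : weight (-2) f -> span (base_monomial Delta (OmA := OmA) 1) (i f * ep).
Proof.
move=> f2; rewrite coframe_exact.1 !mulrDr mulrN -!scalerAr !mulrA -!rmorphM -scaleNr.
apply: spanD; first apply: spanD; [|apply: spanZ..];
  apply/mem_span/base_monomial1 => //.
- exact: weight0_prod f2 weight_al weight_al _.
- exact: weight0_prod f2 weight_al weight_ga _.
- exact: weight0_prod f2 weight_ga weight_ga _.
Qed.

Lemma span_em f : weight 2 f -> span (base_monomial Delta (OmA := OmA) 1) (i f * em).
Proof.
move=> f2; rewrite coframe_exact.2 !mulrDr mulrN -!scalerAr !mulrA -!rmorphM -scaleNr.
apply: spanD; first apply: spanD; [|apply: spanZ..];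
  apply/mem_span/base_monomial1 => //.
- exact: weight0_prod f2 weight_de weight_de _.
- exact: weight0_prod f2 weight_be weight_de _.
- exact: weight0_prod f2 weight_be weight_be _.
Qed.

(** Moving the coefficient [x y], of weight [-2], across [e+] leaves a coefficient
of weight [-2] in front of [e+], to which [span_ep] applies. *)
Lemma span_ep_mul_d f x y z : (x = be \/ x = de) -> (y = be \/ y = de) ->
  weight 0 f -> weight 0 z ->
  span (base_monomial Delta (OmA := OmA) 2) (i f * ep * (i (x * y) * D (i z))).
Proof.
move=> xbd ybd f0 z0; rewrite mulrA; apply: base_span_mul_d z0 _.
have comm u : u = be \/ u = de -> ep * i u = q^-1 *: (i u * ep).
  by case=> ->; rewrite !comm_ep.
have wt u : u = be \/ u = de -> weight (-1) u.
  by case=> ->; [apply: weight_be | apply: weight_de].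
rewrite rmorphM mulrA -(mulrA (i f)) comm // -scalerAr -scalerAl -mulrA -mulrA comm //.
rewrite -!scalerAr !mulrA -!rmorphM -mulrA; do 2!apply: spanZ; apply: span_ep.
exact: weightM f0 (weightM (wt x xbd) (wt y ybd)).
Qed.

Lemma span_ep_em f : weight 0 f ->
  span (base_monomial Delta (OmA := OmA) 2) (i f * (ep * em)).
Proof.
move=> f0; rewrite mulrA coframe_exact.2.
have Sdd := span_ep_mul_d (or_intror erefl) (or_intror erefl) f0 weight_ab.
have Sbd := span_ep_mul_d (or_introl erefl) (or_intror erefl) f0 weight_bc.
have Sbb := span_ep_mul_d (or_introl erefl) (or_introl erefl) f0 weight_cd.
(* Generalize, lest the definition of e+ be expanded by distributivity. *)
move: (i f * ep) Sdd Sbd Sbb => u Sdd Sbd Sbb.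
rewrite !mulrDr mulrN -!scalerAr -scaleNr.
by apply: spanD; [apply: spanD => // |]; apply: spanZ.
Qed.

Lemma podles_calculus : is_calculus (base_inj ext)
  (fun k (w : base) => dga_deg k (val w)) (@base_d _ _ _ T DeltaW).
Proof.
have [P [Q [P0 P1 Q0 Q1]]] := invariant_projections hH hOmH T.
apply: base_calculus => [w /(deg0E (calP OmA))[a wE]|].
  have a0 : weight 0 a.
    by apply: base_form0_weight P0 P1 Q0 Q1 _ _; rewrite -wE base_form_val.
  have aB : a \in eqz_pred Delta (at_tens1 AH) by apply/eqP; rewrite a0 expr0z.
  by exists (Equalizer aB); apply: val_inj.
case=> [|[|[|[|k]]]] w // _ wk; have wb := base_form_val w.
- have [f [g [f2 g2 ->]]] := base_form1_horizontal P0 P1 Q0 Q1 wk wb.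
  by apply: spanD; [apply: span_ep | apply: span_em].
- have [f f0 ->] := base_form2_top P0 P1 Q0 Q1 wk wb.
  exact: span_ep_em.
- by rewrite (base_form3_zero P0 P1 Q0 Q1 wk wb); apply: span0.
- by rewrite (su2_top hOmA _ wk) //; apply: span0.
Qed.

End Podles.

Theorem proposition4p3p18 (R : realType) (q : R[i]) (hq : q != 0)
    (A : algType R[i]) (al be ga de : A) (hA : is_OqSU2 q al be ga de)
    (H : unitAlgType R[i]) (t : H) (hH : is_OU1 t)
    (AH : alg_tensor A H) (Delta : {lrmorphism A -> AH})
    (hDelta : [/\ Delta al = at_tens AH al t, Delta be = at_tens AH be t^-1,
                  Delta ga = at_tens AH ga t & Delta de = at_tens AH de t^-1])
    (OmA : calculus A) (hOmA : is_SU2_calculus q al be ga de OmA)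
    (OmH : calculus H) (hOmH : is_U1_calculus q t OmH)
    (T : dga_tensor OmA OmH) (DeltaW : dga_morphism OmA T)
    (hDeltaW : extends_coaction Delta DeltaW) :
  exists (iotaB : {lrmorphism coinvariants Delta -> base_forms DeltaW})
         (dB : {linear base_forms DeltaW -> base_forms DeltaW}),
    [/\ forall b, val (iotaB b) = cal_inj OmA (val b),
        forall w, val (dB w) = dga_d OmA (val w) &
        is_calculus iotaB (fun k w => dga_deg k (val w)) dB].
Proof.
exists (base_inj hDeltaW), (@base_d _ _ _ T DeltaW); split=> //.
exact: (podles_calculus hq hA hH hDelta hOmA hOmH hDeltaW).
Qed.
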